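(* Let $\Phi=(G,\varphi)$ be a connected $\mathbb{T}$-gain graph with vertex set $V(G)=\{v_1,\dots,v_n\}$. Then $\Phi$ is not vertex order-independent if and only if at least one of the following holds: (i) there exist vertices $v_s,v_t\in V(G)$ such that $\mathcal{P}^{\max}(v_s,v_t)$ contains at least two oriented paths from $v_s$ to $v_t$ having different gains; (ii) there exist vertices $v_s,v_t\in V(G)$ such that $\mathcal{P}^{\min}(v_s,v_t)$ contains at least two oriented paths from $v_s$ to $v_t$ having different gains.
   Context: $\mathbb{T}=\{z\in\mathbb{C}:|z|=1\}$. A $\mathbb{T}$-gain graph $\Phi=(G,\varphi)$ on a simple graph $G$ is a map $\varphi$ assigning to each oriented edge $\overrightarrow{e}_{s,t}$ (for each edge $e_{s,t}$ of $G$) an element of $\mathbb{T}$ with $\varphi(\overrightarrow{e}_{t,s})=\varphi(\overrightarrow{e}_{s,t})^{-1}$. The gain $\varphi(sPt)$ of an oriented path $sPt$ from $s$ to $t$ is the product of the gains of its consecutive oriented edges. $d(s,t)$ is the graph distance in $G$. For $s,t\in V(G)$: $\mathcal{P}(s,t)$ is the set of oriented shortest paths from $s$ to $t$; $\mathcal{P}^{\max}(s,t)$ (resp. $\mathcal{P}^{\min}(s,t)$) is the set of $sPt\in\mathcal{P}(s,t)$ whose gain has maximum (resp. minimum) real part among all paths in $\mathcal{P}(s,t)$. Given a total order $<$ on $V(G)$, define $\varphi^{<}_{\max}(s,t)$ for $s<t$ as the gain $\varphi(sPt)$ of a path $sPt\in\mathcal{P}^{\max}(s,t)$ whose gain has maximum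 imaginary part among paths in $\mathcal{P}^{\max}(s,t)$, and $\varphi^{<}_{\max}(t,s)=\overline{\varphi^{<}_{\max}(s,t)}$; similarly $\varphi^{<}_{\min}(s,t)$ for $s<t$ is the gain of a path in $\mathcal{P}^{\min}(s,t)$ whose gain has minimum imaginary part among paths in $\mathcal{P}^{\min}(s,t)$, and $\varphi^{<}_{\min}(t,s)=\overline{\varphi^{<}_{\min}(s,t)}$. The gain distance matrices are $D^{\max}_{<}(\Phi)=(\varphi^{<}_{\max}(v_i,v_j)d(v_i,v_j))_{i,j}$ and $D^{\min}_{<}(\Phi)=(\varphi^{<}_{\min}(v_i,v_j)d(v_i,v_j))_{i,j}$. The standard order is $v_1<v_2<\dots<v_n$, and $<_r$ denotes its reverse. $\Phi$ is vertex order-independent if $D^{\max}_{<}(\Phi)=D^{\max}_{<_r}(\Phi)$ and $D^{\min}_{<}(\Phi)=D^{\min}_{<_r}(\Phi)$ for the standard order $<$. *)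

(* Defs.v *)
From HB Require Import structures.
From mathcomp Require Import all_boot all_order all_algebra.
From mathcomp Require Import reals.
From mathcomp Require Export complex.

Set Implicit Arguments.
Unset Strict Implicit.
Unset Printing Implicit Defensive.

Import Order.TTheory GRing.Theory Num.Theory.
Local Open Scope ring_scope.

(* The vertices v_1, ..., v_n are the elements of 'I_n, and R[i] is the field
   of complex numbers.  [gain s t] is the gain of the edge st oriented from s to
   t; it is unconstrained, and never used, when s and t are not adjacent. *)
Record gain_graph (R : realType) (n : nat) := GainGraph {
  edge : rel 'I_n;
  edge_sym : symmetric edge;
  edge_irr : irreflexive edge;
  gain : 'I_n -> 'I_n -> R[i];
  gain_norm : forall s t, edge s t -> `|gain s t| = 1;
  gain_inv : forall s t, edge s t -> gain t s = (gain s t)^-1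
}.

Section GainGraph.
Variables (R : realType) (n : nat) (Phi : gain_graph R n).

Definition connected_graph := forall s t : 'I_n, connect (edge Phi) s t.

(* An oriented path from s is represented by the sequence p of its vertices
   other than s, so [size p] is its number of edges. *)
Definition is_path (s t : 'I_n) (p : seq 'I_n) : bool :=
  [&& path (edge Phi) s p, uniq (s :: p) & last s p == t].

Fixpoint path_gain (s : 'I_n) (p : seq 'I_n) : R[i] :=
  if p is t :: p' then gain Phi s t * path_gain t p' else 1.

(* The least length of a path from s to t: a path has fewer than n edges.
   The value is n if there is no path. *)
Definition dist (s t : 'I_n) : nat :=
  find (fun k => [exists p : k.-tuple 'I_n, is_path s t p]) (iota 0 n).

Definition shortest_paths (s t : 'I_n) : {set (dist s t).-tuple 'I_n} :=
  [set p : (dist s t).-tuple 'I_n | is_path s t p].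

Definition Pmax (s t : 'I_n) : {set (dist s t).-tuple 'I_n} :=
  [set p in shortest_paths s t | [forall q in shortest_paths s t,
     complex.Re (path_gain s q) <= complex.Re (path_gain s p)]].

Definition Pmin (s t : 'I_n) : {set (dist s t).-tuple 'I_n} :=
  [set p in shortest_paths s t | [forall q in shortest_paths s t,
     complex.Re (path_gain s p) <= complex.Re (path_gain s q)]].

(* The choice of the path does not matter: its gain is determined by its real
   and imaginary parts.  The value 0 is taken only if there is no path. *)
Definition max_gain (s t : 'I_n) : R[i] :=
  if [pick p in Pmax s t | [forall q in Pmax s t,
        complex.Im (path_gain s q) <= complex.Im (path_gain s p)]] is Some p
  then path_gain s p else 0.

Definition min_gain (s t : 'I_n) : R[i] :=
  if [pick p in Pmin s t | [forall q in Pmin s t,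
        complex.Im (path_gain s p) <= complex.Im (path_gain s q)]] is Some p
  then path_gain s p else 0.

(* [lt] is a strict total order on the vertices.  The last branch is the case
   s = t, where the only path is trivial, with gain 1. *)
Definition phi_max (lt : rel 'I_n) (s t : 'I_n) : R[i] :=
  if lt s t then max_gain s t
  else if lt t s then conjc (max_gain t s) else 1.

Definition phi_min (lt : rel 'I_n) (s t : 'I_n) : R[i] :=
  if lt s t then min_gain s t
  else if lt t s then conjc (min_gain t s) else 1.

Definition Dmax (lt : rel 'I_n) : 'M[R[i]]_n :=
  \matrix_(i < n, j < n) (phi_max lt i j * (dist i j)%:R).

Definition Dmin (lt : rel 'I_n) : 'M[R[i]]_n :=
  \matrix_(i < n, j < n) (phi_min lt i j * (dist i j)%:R).

Definition std_lt : rel 'I_n := fun i j => (i < j)%N.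
Definition rev_lt : rel 'I_n := fun i j => std_lt j i.

Definition vertex_order_independent : Prop :=
  Dmax std_lt = Dmax rev_lt /\ Dmin std_lt = Dmin rev_lt.

End GainGraph.

(* Main.v *)
Require Import Defs.
From mathcomp Require Import all_boot all_order all_algebra.
From mathcomp Require Import reals.

(** Reversing a path conjugates its gain, so the gains of the shortest paths
    from s to t are the conjugates of those from t to s: the real parts agree
    and the imaginary parts change sign.  Hence phi_max(s,t) computed in an order
    with s < t is the gain of largest imaginary part in P^max(s,t), and computed
    in the reverse order it is the one of smallest imaginary part.  As the real
    part is constant on P^max(s,t), the two differ iff P^max(s,t) contains two
    different gains.  The case of P^min is the same for the opposite order on R. *)

Set Implicit Arguments.
Unset Strict Implicit.
Unset Printing Implicit Defensive.

Import Order.TTheory GRing.Theory Num.Theory.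
Local Open Scope ring_scope.
Local Open Scope complex_scope.

Section ComplexConjugate.
Variable R : pzRingType.

Lemma Re_conjc (z : R[i]) : complex.Re z^* = complex.Re z.
Proof. by case: z. Qed.

Lemma Im_conjc (z : R[i]) : complex.Im z^* = - complex.Im z.
Proof. by case: z. Qed.

End ComplexConjugate.

Lemma exists_greatest (T : finType) (V : eqType) (leV : rel V) (f : T -> V)
    (A : {set T}) :
    transitive leV -> total leV -> A != set0 ->
  exists2 x, x \in A & [forall y in A, leV (f y) (f x)].
Proof.
move=> leV_trans leV_total /set0Pn[x0 x0A].
have geV_refl : reflexive (fun a b => leV b a).
  by move=> a; have := leV_total a a; rewrite orbb.
have geV_trans : transitive (fun a b => leV b a).
  by move=> b a c ba cb; apply: leV_trans cb ba.
have geV_total : total (fun a b => leV b a) by move=> a b; apply: leV_total.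
have [x xA x_greatest] :=
  extremumP (P := mem A) f geV_refl geV_trans geV_total x0A.
by exists x => //; apply/forall_inP.
Qed.

Section LexicographicExtremum.
Variables (R : pzRingType) (leR : rel R).

Definition Re_extremal (T : finType) (f : T -> R[i]) (A : {set T}) : {set T} :=
  [set x in A | [forall y in A, leR (complex.Re (f y)) (complex.Re (f x))]].

Definition lex_extremum (T : finType) (f : T -> R[i]) (A : {set T}) : R[i] :=
  if [pick x in Re_extremal f A | [forall y in Re_extremal f A,
        leR (complex.Im (f y)) (complex.Im (f x))]] is Some x
  then f x else 0.

Lemma mem_image_Re_extremal (T : finType) (f : T -> R[i]) (A : {set T}) z :
  (z \in [seq f x | x in Re_extremal f A]) =
  (z \in [seq f x | x in A]) &&
    all (fun w => leR (complex.Re w) (complex.Re z)) [seq f x | x in A].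
Proof.
apply/imageP/andP => [[x] | [/imageP[x xA ->] /allP fx_ext]].
  rewrite inE => /andP[xA /forall_inP x_ext] ->; split; first exact: image_f.
  by apply/allP => _ /imageP[y yA ->]; apply: x_ext.
exists x; rewrite // inE xA; apply/forall_inP => y yA.
by apply: fx_ext; apply: image_f.
Qed.

Lemma eq_image_Re_extremal (T T' : finType) (f : T -> R[i]) (g : T' -> R[i])
    (A : {set T}) (B : {set T'}) :
    [seq f x | x in A] =i [seq g y | y in B] ->
  [seq f x | x in Re_extremal f A] =i [seq g y | y in Re_extremal g B].
Proof. by move=> fgE z; rewrite !mem_image_Re_extremal fgE (eq_all_r fgE). Qed.

Lemma Re_extremal_conjc (T : finType) (f : T -> R[i]) (A : {set T}) :
  Re_extremal (fun x => (f x)^*) A = Re_extremal f A.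
Proof.
apply/setP => x; rewrite !inE; congr (_ && _).
by apply: eq_forallb => y; rewrite !Re_conjc.
Qed.

Hypotheses (leR_anti : antisymmetric leR) (leR_trans : transitive leR).
Hypothesis leR_total : total leR.

Lemma Re_extremal_neq0 (T : finType) (f : T -> R[i]) (A : {set T}) :
  A != set0 -> Re_extremal f A != set0.
Proof.
move=> A_neq0; have [x xA x_ext] :=
  exists_greatest (fun x => complex.Re (f x)) leR_trans leR_total A_neq0.
by apply/set0Pn; exists x; rewrite inE xA.
Qed.

Lemma lex_extremumP (T : finType) (f : T -> R[i]) (A : {set T}) :
    A != set0 ->
  exists x, [/\ x \in Re_extremal f A, lex_extremum f A = f x
    & {in Re_extremal f A, forall y,
        leR (complex.Im (f y)) (complex.Im (f x))}].
Proof.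
move=> A_neq0; rewrite /lex_extremum.
case: pickP => [x /andP[xA /forall_inP x_ext] | none]; first by exists x.
have [x xA x_ext] :=
  exists_greatest (fun x => complex.Im (f x)) leR_trans leR_total
    (Re_extremal_neq0 f A_neq0).
by have := none x; rewrite xA x_ext.
Qed.

Lemma eq_Re_extremal (T : finType) (f : T -> R[i]) (A : {set T}) :
  {in Re_extremal f A &, forall x y, complex.Re (f x) = complex.Re (f y)}.
Proof.
move=> x y; rewrite !inE => /andP[xA /forall_inP x_ext].
case/andP=> yA /forall_inP y_ext.
by apply: leR_anti; rewrite x_ext ?y_ext.
Qed.

Hypothesis leR_opp : {mono -%R : a b /~ leR a b}.

(* The conjugate of [lex_extremum g B] is the value of [f] on [Re_extremal f A]
   whose imaginary part is least, while [lex_extremum f A] is the one whose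
   imaginary part is greatest. *)
Lemma lex_extremum_conjcPn (T T' : finType) (f : T -> R[i]) (g : T' -> R[i])
    (A : {set T}) (B : {set T'}) :
    A != set0 -> [seq f x | x in A] =i [seq (g y)^* | y in B] ->
  reflect (exists x y, [/\ x \in Re_extremal f A, y \in Re_extremal f A
                         & f x <> f y])
          (lex_extremum f A != (lex_extremum g B)^*).
Proof.
move=> A_neq0 fgE; have := eq_image_Re_extremal fgE.
rewrite Re_extremal_conjc => fg_extE.
have B_neq0 : B != set0.
  case/set0Pn: A_neq0 => x xA.
  have /imageP[y yB _] : f x \in [seq (g y)^* | y in B].
    by rewrite -fgE image_f.
  by apply/set0Pn; exists y.
apply: (equivP idP).
have [x [xA -> x_max]] := lex_extremumP f A_neq0.
have [y [yB -> y_max]] := lex_extremumP g B_neq0.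
split=> [/eqP fx_neq | [x1 [x2 [x1A x2A]]]].
  have /imageP[x' x'A gyE] : (g y)^* \in [seq f x | x in Re_extremal f A].
    by rewrite fg_extE (image_f (fun y => (g y)^*)).
  by exists x, x'; rewrite -gyE.
apply: contra_notN => /eqP fxE.
suff f_const : {in Re_extremal f A, forall z, f z = f x} by rewrite !f_const.
move=> z zA; apply/eqP.
rewrite eq_complex (eq_Re_extremal zA xA) eqxx; apply/eqP.
apply: leR_anti; rewrite x_max //=.
have /imageP[w wB ->] : f z \in [seq (g y)^* | y in Re_extremal g B].
  by rewrite -fg_extE image_f.
by rewrite fxE !Im_conjc leR_opp y_max.
Qed.

End LexicographicExtremum.

Section PathReversal.
Variables (R : realType) (n : nat) (Phi : gain_graph R n).
Implicit Types (s t : 'I_n) (p : seq 'I_n).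

Definition reverse_path s p : seq 'I_n := rev (belast s p).

Lemma size_reverse_path s p : size (reverse_path s p) = size p.
Proof. by rewrite size_rev size_belast. Qed.

Lemma last_reverse_path s p : last (last s p) (reverse_path s p) = s.
Proof. by case: p => //= t p; rewrite /reverse_path rev_cons last_rcons. Qed.

Lemma is_path_reverse s t p :
  is_path Phi s t p -> is_path Phi t s (reverse_path s p).
Proof.
case/and3P=> edges_p uniq_p /eqP <-; apply/and3P; split.
- by rewrite rev_path (eq_path (e' := edge Phi)) // => x y; rewrite edge_sym.
- by rewrite -rev_rcons -lastI rev_uniq.
- by rewrite last_reverse_path.
Qed.

Lemma gain_conjc s t : edge Phi s t -> gain Phi t s = (gain Phi s t)^*.
Proof.
move=> st; rewrite (gain_inv st).
by rewrite (invC_norm (gain Phi s t)) (gain_norm st) expr1n invr1 mul1r.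
Qed.

Lemma path_gain_rcons s p t :
  path_gain Phi s (rcons p t) = path_gain Phi s p * gain Phi (last s p) t.
Proof.
elim: p s => [|u p IHp] s /=; first by rewrite mulr1 mul1r.
by rewrite IHp mulrA.
Qed.

Lemma path_gain_reverse s p : path (edge Phi) s p ->
  path_gain Phi (last s p) (reverse_path s p) = (path_gain Phi s p)^*.
Proof.
elim: p s => [|u p IHp] s /=; first by rewrite oppr0.
case/andP=> su edges_p; rewrite /reverse_path /= rev_cons path_gain_rcons.
by rewrite IHp // last_reverse_path (gain_conjc su) [RHS]rmorphM mulrC.
Qed.

Lemma dist_sym s t : dist Phi s t = dist Phi t s.
Proof.
apply: eq_find => k.
by apply/existsP/existsP => -[p /is_path_reverse pP];
  [exists [tuple of rev (belast s p)] | exists [tuple of rev (belast t p)]].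
Qed.

Lemma shortest_paths_reverse s t (p : (dist Phi s t).-tuple 'I_n) :
  p \in shortest_paths Phi s t ->
  exists2 q : (dist Phi t s).-tuple 'I_n, q \in shortest_paths Phi t s
    & path_gain Phi t q = (path_gain Phi s p)^*.
Proof.
rewrite inE => pP.
have size_q : size (reverse_path s p) == dist Phi t s.
  by rewrite size_reverse_path size_tuple dist_sym.
exists (Tuple size_q); first by rewrite inE is_path_reverse.
by case/and3P: pP => edges_p _ /eqP {1}<-; apply: path_gain_reverse.
Qed.

Lemma image_path_gain_reverse s t :
  [seq path_gain Phi s p | p : _.-tuple _ in shortest_paths Phi s t] =i
  [seq (path_gain Phi t q)^* | q : _.-tuple _ in shortest_paths Phi t s].
Proof.
move=> z; apply/imageP/imageP => -[p pP ->];
  have [q qP qE] := shortest_paths_reverse pP; exists q => //.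
by rewrite qE conjcK.
Qed.

Lemma is_path_loop s p : is_path Phi s s p -> p = [::].
Proof.
case/and3P=> _; case: p => //= u p /andP[s_notin _] /eqP last_s.
by rewrite -{1}last_s mem_last in s_notin.
Qed.

End PathReversal.

Section ConnectedGainGraph.
Variables (R : realType) (n : nat) (Phi : gain_graph R n).
Hypothesis conn : connected_graph Phi.
Implicit Types (s t : 'I_n) (g : 'I_n -> 'I_n -> R[i]) (lt : rel 'I_n).

Lemma shortest_paths_neq0 s t : shortest_paths Phi s t != set0.
Proof.
have /connectP[p0 edges_p0 ->] := conn s t.
case: (shortenP edges_p0) => p edges_p uniq_p _; set u := last s p.
have size_p : (size p < n)%N.
  by have := max_card (mem (s :: p)); rewrite (card_uniqP uniq_p) card_ord.
have some_path :
    has (fun k => [exists q : k.-tuple 'I_n, is_path Phi s u q]) (iota 0 n).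
  apply/hasP; exists (size p); first by rewrite mem_iota.
  by apply/existsP; exists (in_tuple p); apply/and3P.
have := nth_find 0%N some_path.
rewrite has_find size_iota in some_path; rewrite nth_iota //.
by case/existsP=> q qP; apply/set0Pn; exists q; rewrite inE.
Qed.

Lemma dist_neq0 s t : s != t -> dist Phi s t != 0%N.
Proof.
have [p] := set0Pn _ (shortest_paths_neq0 s t).
rewrite inE => /and3P[_ _ /eqP last_p].
apply: contraNneq => dist0; rewrite -last_p.
by have /size0nil-> : size p = 0%N by rewrite size_tuple.
Qed.

Definition hermitian_gain g lt s t : R[i] :=
  if lt s t then g s t else if lt t s then (g t s)^* else 1.

Definition gain_distance_matrix g lt : 'M[R[i]]_n :=
  \matrix_(s < n, t < n) (hermitian_gain g lt s t * (dist Phi s t)%:R).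

Lemma gain_distance_matrix_revPn g lt :
    (forall s t, s != t -> lt t s = ~~ lt s t) ->
  reflect (exists s t, s != t /\ g s t != (g t s)^*)
    (gain_distance_matrix g lt != gain_distance_matrix g (fun s t => lt t s)).
Proof.
move=> lt_trichotomy; rewrite -subr_eq0.
have gainB_neq0 s t : s != t ->
    (hermitian_gain g lt s t - hermitian_gain g (fun u v => lt v u) s t != 0)
    = (g s t != (g t s)^*).
  move=> st; rewrite subr_eq0 /hermitian_gain (lt_trichotomy _ _ st).
  by case: (lt s t); rewrite //= eq_sym.
apply: (iffP (matrix0Pn _)) => -[s [t]].
  rewrite !mxE -mulrBl mulf_eq0 negb_or => /andP[gainB _]; exists s, t.
  suff st : s != t by rewrite -gainB_neq0.
  by apply: contraNneq gainB => ->; rewrite subrr.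
case=> st g_neq; exists s, t; rewrite !mxE -mulrBl mulf_neq0 ?gainB_neq0 //.
by rewrite pnatr_eq0 dist_neq0.
Qed.

Lemma std_lt_trichotomy s t : s != t -> std_lt t s = ~~ std_lt s t.
Proof. by rewrite -val_eqE eq_sym /std_lt -leqNgt ltn_neqAle => ->. Qed.

Variable leR : rel R.

(* By conversion, these notions are those of [Pmax] and [max_gain] when [leR] is
   [<=%R], and those of [Pmin] and [min_gain] when [leR] is [>=%R]. *)
Definition extremal_paths s t : {set (dist Phi s t).-tuple 'I_n} :=
  Re_extremal leR (fun p : _.-tuple _ => path_gain Phi s p)
    (shortest_paths Phi s t).

Definition extremal_gain s t : R[i] :=
  lex_extremum leR (fun p : _.-tuple _ => path_gain Phi s p)
    (shortest_paths Phi s t).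

Hypotheses (leR_anti : antisymmetric leR) (leR_trans : transitive leR).
Hypotheses (leR_total : total leR) (leR_opp : {mono -%R : a b /~ leR a b}).

Lemma extremal_gain_conjcPn s t :
  reflect (exists p q, [/\ p \in extremal_paths s t, q \in extremal_paths s t
                         & path_gain Phi s p <> path_gain Phi s q])
          (extremal_gain s t != (extremal_gain t s)^*).
Proof.
apply: lex_extremum_conjcPn => //; first exact: shortest_paths_neq0.
exact: image_path_gain_reverse.
Qed.

Lemma extremal_distance_matrix_revPn :
  reflect (exists (s t : 'I_n) (p q : (dist Phi s t).-tuple 'I_n),
             [/\ p \in extremal_paths s t, q \in extremal_paths s t
               & path_gain Phi s p <> path_gain Phi s q])
    (gain_distance_matrix extremal_gain (@std_lt n)
     != gain_distance_matrix extremal_gain (@rev_lt n)).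
Proof.
apply: (iffP (gain_distance_matrix_revPn _ std_lt_trichotomy)) => -[s [t]].
  by case=> _ /extremal_gain_conjcPn[p [q pqP]]; exists s, t, p, q.
move=> pqP; exists s, t; split; last exact/extremal_gain_conjcPn.
apply/eqP => st; subst t; case: pqP => p [q []].
rewrite !inE => /andP[/is_path_loop-> _] /andP[/is_path_loop-> _].
by case.
Qed.

End ConnectedGainGraph.

Theorem theorem3p6 (R : realType) (n : nat) (Phi : gain_graph R n)
    (conn : connected_graph Phi) :
  ~ vertex_order_independent Phi <->
  (exists (s t : 'I_n) (p q : (dist Phi s t).-tuple 'I_n),
      [/\ p \in Pmax Phi s t, q \in Pmax Phi s t
        & path_gain Phi s p <> path_gain Phi s q]) \/
  (exists (s t : 'I_n) (p q : (dist Phi s t).-tuple 'I_n),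
      [/\ p \in Pmin Phi s t, q \in Pmin Phi s t
        & path_gain Phi s p <> path_gain Phi s q]).
Proof.
have DmaxPn := extremal_distance_matrix_revPn conn (leR := <=%R)
  le_anti le_trans le_total (@lerN2 R).
have DminPn := extremal_distance_matrix_revPn conn (leR := >=%R)
  ge_anti ge_trans ge_total (fun a b => lerN2 b a).
split=> [dependent | [/DmaxPn/eqP | /DminPn/eqP] D_neq []] //.
have [DmaxE | /DmaxPn] := eqVneq (Dmax Phi (@std_lt n)) (Dmax Phi (@rev_lt n));
  last by left.
have [DminE | /DminPn] := eqVneq (Dmin Phi (@std_lt n)) (Dmin Phi (@rev_lt n));
  last by right.
by case: dependent.
Qed.
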